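(* Let $n,r,m,d,k$ be positive integers with $n=rm=dk$, and let $\gamma_n=(1,2,\dots,n)$. Set \[ {\rm Par}(m;d,r)=\{\mu=(\mu_1,\ldots,\mu_{l(\mu)})\vdash m:\ \mu_i\mid d\mid r\mu_i\text{ for all } i\in[l(\mu)]\}. \] Then \[ \sum_{j=0}^{n-1}\big|C_{S_n}(\gamma_n^k)\cap S_{r^m,j}\big|\,t^j=\sum_{\mu\in{\rm Par}(m;d,r)}\pi_{\frac rd\mu}\prod_{i=1}^{l(\mu)}\Big(tA_{\frac rd\mu_i-1}(t)[d]_t^{\frac rd\mu_i}\Big)_{d,\mu_i}. \]
   Context: Permutations act on the right; ${\rm exc}(\sigma)=|\{i\in[s-1]:i\sigma>i\}|$ for $\sigma\in S_s$. $S_{r^m,j}$ is the set of $\sigma\in S_n$ with cycle type $r^m$ ($m$ cycles of length $r$) and ${\rm exc}(\sigma)=j$; $C_{S_n}(\gamma_n^k)$ is the centralizer of $\gamma_n^k$. For a partition $\mu$ and rational $q$ with all $q\mu_i$ positive integers, $q\mu=(q\mu_1,\dots)$. For a partition $\nu$ of $N$ with parts $\nu_1,\dots,\nu_l$, $\pi_\nu=\binom{N}{\nu_1,\dots,\nu_l}/\prod_jm_j(\nu)!$, $m_j(\nu)$ the number of parts equal to $j$. $A_s(t)=\sum_{\sigma\in S_s}t^{{\rm exc}(\sigma)}$ ($A_0=1$), $[d]_t=1+t+\cdots+t^{d-1}$, and for $f(t)=\sum_ia_it^i$, $f(t)_{b,c}=\sum_{i:\gcd(i,b)=c}a_it^i$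 (with $\gcd(0,b)=b$).
   Formalization: The formal statement assumes r ≥ 2 instead of r ≥ 1: for r = 1 the printed identity always fails, since the left side is 1 while the right side is t^n (e.g. n=r=m=d=k=1 gives 1 versus t). *)

(* Defs.v *)
From HB Require Import structures.
From mathcomp Require Import all_boot all_order all_algebra all_fingroup.

Set Implicit Arguments.
Unset Strict Implicit.
Unset Printing Implicit Defensive.

Import GRing.Theory.

(* MathComp permutations already act on the right: (s * u) x = u (s x).
   The set {1, ..., n} is represented by 'I_n = {0, ..., n - 1}. *)

(* The largest point can never be an excedance, so letting i range over all
   of 'I_n agrees with letting it range over [n - 1]. *)
Definition exc (n : nat) (s : 'S_n) : nat := #|[set i : 'I_n | i < s i]|.

(* The n-cycle i |-> i + 1 mod n. *)
Definition gamma (n : nat) : 'S_n := perm (@ordS_inj n).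

Definition cycle_type (n : nat) (s : 'S_n) : seq nat :=
  sort geq [seq #|c| | c : {set 'I_n} in porbits s].

Definition S_rect (n r m j : nat) : {set 'S_n} :=
  [set s : 'S_n | (cycle_type s == nseq m r) && (exc s == j)].

Definition is_partn (m : nat) (mu : seq nat) : bool :=
  [&& sorted geq mu, all (ltn 0) mu & sumn mu == m].

Record partn (m : nat) := Partn {
  partn_val :> seq nat;
  partn_valP : is_partn m partn_val }.

HB.instance Definition _ (m : nat) := [isSub for @partn_val m].
HB.instance Definition _ (m : nat) := [Countable of partn m by <:].

(* Finiteness of partn m: a partition of m is a sequence of length at most m
   with entries in {0, ..., m}. *)
Definition partn_to_bseq (m : nat) (mu : partn m) : m.-bseq 'I_m.+1 :=
  insub_bseq m [seq inord i | i <- mu].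

Definition bseq_to_partn (m : nat) (b : m.-bseq 'I_m.+1) : option (partn m) :=
  insub [seq val i | i <- b].

Lemma partn_to_bseqK (m : nat) : pcancel (@partn_to_bseq m) (@bseq_to_partn m).
Proof.
move=> mu; rewrite /bseq_to_partn /partn_to_bseq.
have /and3P[_ mu_gt0 /eqP sum_mu] := partn_valP mu.
have size_mu : size mu <= m.
  rewrite -[leqRHS]sum_mu; elim: (partn_val mu) mu_gt0 => //= x s IHs /andP[x0 /IHs sz].
  by rewrite -add1n leq_add.
have le_mu i : i \in partn_val mu -> i < m.+1.
  rewrite ltnS -[leqRHS]sum_mu; elim: (partn_val mu) => //= x s IHs.
  rewrite inE => /predU1P[->|/IHs le_i]; first exact: leq_addr.
  exact: leq_trans le_i (leq_addl _ _).
have -> : [seq val i | i <- insub_bseq m [seq @inord m i | i <- mu]] = mu.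
  rewrite /insub_bseq val_insubd size_map size_mu -map_comp.
  by apply/map_id_in => i /le_mu i_le /=; rewrite inordK.
exact: valK.
Qed.

HB.instance Definition _ (m : nat) :=
  isFinite.Build (partn m) (pcan_enumP (@partn_to_bseqK m)).

Definition Par (m d r : nat) : {set partn m} :=
  [set mu : partn m | all (fun i => (i %| d) && (d %| r * i)) mu].

(* (r / d) * x; the division is exact whenever x is a part of some
   mu \in Par m d r. *)
Definition scale_part (r d x : nat) : nat := (r * x) %/ d.

Local Open Scope ring_scope.

(* Only the values j that occur as parts are needed in the second product:
   the other ones contribute 0`! = 1. *)
Definition pi_partn (nu : seq nat) : rat :=
  (sumn nu)`!%:R / (\prod_(x <- nu) x`!%:R)
    / (\prod_(j <- undup nu) (count_mem j nu)`!%:R).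

Definition eulerian (s : nat) : {poly rat} := \sum_(w : 'S_s) 'X^(exc w).

Definition tbracket (d : nat) : {poly rat} := \sum_(i < d) 'X^i.

Definition gcd_part (f : {poly rat}) (b c : nat) : {poly rat} :=
  \sum_(i < size f | gcdn i b == c) f`_i *: 'X^i.

(* Main.v *)
Require Import Defs.
From mathcomp Require Import all_boot all_order all_algebra all_fingroup.
From mathcomp Require Import zify ring.

Set Implicit Arguments.
Unset Strict Implicit.
Unset Printing Implicit Defensive.

Import GRing.Theory Num.Theory.

(* A permutation commuting with gamma_n^k amounts to a permutation w of the k
   residues mod k together with a shift in Z/d for each residue.  Normalised
   suitably, the shift at j is -e_j, where e_j is the number of excedances among
   the d points above j; it runs over {1, ..., d} if j is an excedance of w and
   over {0, ..., d-1} otherwise.  A cycle C of w lifts to cycles of length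
   |C| d / gcd(sum_{j in C} e_j, d), so the generating function is the sum over w
   of a product over the cycles C of w of the gcd-part of t^exc(w|C) [d]_t^|C|.
   Summing over all cyclic permutations of C replaces t^exc by t A_{|C|-1}(t)
   (when |C| = 1 this changes only exponents 0 and d, irrelevant as r > 1).
   Finally, sums over permutations of products of cycle weights and sums over
   partitions nu weighted by pi_nu obey the same recurrence
   k F_k = sum_l l binom(k, l) W_l F_{k-l}, obtained by marking a point. *)

(** * Sums over partitions *)

Definition partns (k : nat) : seq (seq nat) := [seq val nu | nu : Defs.partn k].

Lemma mem_partns k s : (s \in partns k) = is_partn k s.
Proof.
apply/imageP/idP => [[nu _ ->]|sP]; first exact: partn_valP.
by exists (Partn sP).
Qed.

Lemma partns_uniq k : uniq (partns k).
Proof. by rewrite map_inj_uniq ?enum_uniq //; apply: val_inj. Qed.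

Lemma geq_total : total geq. Proof. by move=> x y; apply: leq_total. Qed.
Lemma geq_trans : transitive geq.
Proof. by move=> x y z /= h1 h2; apply: leq_trans h2 h1. Qed.
Lemma geq_anti : antisymmetric geq.
Proof. by move=> x y /andP[h1 h2]; apply/eqP; rewrite eqn_leq; apply/andP. Qed.

Lemma leq_sumn s x : x \in s -> x <= sumn s.
Proof.
elim: s => //= y s IHs; rewrite inE => /predU1P[->|/IHs h]; first exact: leq_addr.
exact: leq_trans h (leq_addl _ _).
Qed.

Lemma sumn_count k s : all (fun x => x <= k) s ->
  sumn s = \sum_(l < k.+1) l * count_mem (l : nat) s.
Proof.
elim: s => /= [_|x s IHs /andP[xk /IHs ->]].
  by rewrite big1 // => l _; rewrite muln0.
rewrite [RHS](eq_bigr (fun l : 'I_k.+1 => l * (x == l) + l * count_mem (l : nat) s));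
  last by move=> l _; rewrite mulnDr.
rewrite big_split /=; congr addn.
have xk' : x < k.+1 by [].
rewrite (bigD1 (Ordinal xk')) //= eqxx muln1 big1 ?addn0 // => i ne.
have -> : x == i = false by apply/negP => /eqP e; case/eqP: ne; apply: val_inj.
by rewrite muln0.
Qed.

Section PartitionRecurrence.
Local Open Scope ring_scope.

(** Running over every [j <= k], not only over the distinct parts, lets a prepended part change a
    single factor. *)
Definition mult_fact (k : nat) (s : seq nat) : rat :=
  \prod_(j < k.+1) (count_mem (j : nat) s)`!%:R.

Lemma prod_undup_count k (s : seq nat) : all (fun x => (x <= k)%N) s ->
  \prod_(j <- undup s) (count_mem j s)`!%:R = mult_fact k s.
Proof.
move=> sk; rewrite /mult_fact -(big_mkord xpredT (fun j => (count_mem j s)`!%:R)).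
rewrite [RHS](bigID (fun j => j \in s)) /= [X in _ * X]big1 ?mulr1; last first.
  by move=> j js; rewrite (count_memPn js).
rewrite -[RHS]big_filter; apply: perm_big; apply: uniq_perm.
- exact: undup_uniq.
- by rewrite filter_uniq // iota_uniq.
move=> j; rewrite mem_undup mem_filter mem_index_iota andbC /=.
by case: (boolP (j \in s)) => [/(allP sk)/= |]; rewrite ?andbF ?andbT.
Qed.

Lemma mult_fact_cons k l s : (l <= k)%N ->
  mult_fact k (l :: s) = (count_mem l s).+1%:R * mult_fact k s.
Proof.
move=> lk; rewrite /mult_fact.
have lk' : (l < k.+1)%N by [].
rewrite (bigD1 (Ordinal lk')) //= eqxx add1n factS natrM -mulrA; congr (_ * _).
rewrite [RHS](bigD1 (Ordinal lk')) //=; congr (_ * _).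
apply: eq_bigr => i ne.
have -> : l == i = false by apply/negP => /eqP e; case/eqP: ne; apply: val_inj.
by [].
Qed.

Lemma is_partn_le k s : is_partn k s -> all (fun x => (x <= k)%N) s.
Proof. by case/and3P=> _ _ /eqP <-; apply/allP => x; apply: leq_sumn. Qed.

(** For [l > 0] both sides count the set partitions of a k-set of type [l :: s] with one block of
    size [l] marked; on the right the marked block is chosen first. *)
Lemma pi_partn_cons k l s : is_partn (k - l) s -> (l <= k)%N ->
  pi_partn (l :: s) * (count_mem l (l :: s))%:R = 'C(k, l)%:R * pi_partn s.
Proof.
move=> sP lk; have sk := is_partn_le sP.
have sk' : all (fun x => (x <= k)%N) s.
  by apply: sub_all sk => x /leq_trans; apply; rewrite leq_subr.
rewrite /pi_partn (@prod_undup_count k) /= ?lk //.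
rewrite (@prod_undup_count k) // mult_fact_cons // big_cons eqxx add1n.
have /and3P[_ _ /eqP ->] := sP; rewrite subnKC //.
have f0 j : j`!%:R != 0 :> rat by rewrite pnatr_eq0 -lt0n fact_gt0.
have m0 : mult_fact k s != 0 by apply/prodf_neq0 => j _.
have p0 : \prod_(x <- s) x`!%:R != 0 :> rat.
  by rewrite prodf_seq_neq0; apply/allP => x _ /=; apply: f0.
have c0 : (count_mem l s).+1%:R != 0 :> rat by rewrite pnatr_eq0.
rewrite -(bin_fact lk) !natrM; move: (_.+1%:R) c0 => c c0.
by field; rewrite m0 p0 c0 !f0.
Qed.

Lemma perm_pi_partn s t : perm_eq s t -> pi_partn s = pi_partn t.
Proof.
move=> st; rewrite /pi_partn (perm_sumn st) (perm_big _ st) /=; congr (_ / _).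
rewrite (perm_big _ (perm_undup (perm_mem st))) /=.
by apply: eq_bigr => j _; rewrite (seq.permP st).
Qed.

Definition insert_part l s := sort geq (l :: s).

Lemma perm_insert_part l s : perm_eq (insert_part l s) (l :: s).
Proof. by rewrite perm_sort. Qed.

Lemma is_partn_insert k l s : (0 < l <= k)%N ->
  is_partn (k - l) s -> is_partn k (insert_part l s).
Proof.
case/andP=> l0 lk /and3P[_ s0 /eqP sk]; have st := perm_insert_part l s.
rewrite /is_partn sort_sorted; last exact: geq_total.
rewrite (perm_all _ st) /= l0 s0 (perm_sumn st) /= sk subnKC //.
Qed.

(** Removing one copy of [l] inverts the insertion, since sorted sequences that agree up to
    permutation are equal. *)
Lemma partns_insert k l : (0 < l <= k)%N ->
  perm_eq [seq s <- partns k | l \in s] [seq insert_part l s | s <- partns (k - l)].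
Proof.
move=> lk; apply: uniq_perm; first by rewrite filter_uniq // partns_uniq.
  rewrite map_inj_in_uniq ?partns_uniq // => s t; rewrite !mem_partns.
  move=> /and3P[ss _ _] /and3P[tt _ _] e; apply: (sorted_eq geq_trans geq_anti) => //.
  rewrite -(perm_cons l); apply: perm_trans (perm_insert_part l t).
  by rewrite -e perm_sym perm_insert_part.
move=> s; rewrite mem_filter mem_partns; apply/andP/mapP => [[ls sP]|[t]]; last first.
  rewrite mem_partns => tP ->.
  by rewrite (perm_mem (perm_insert_part l t)) mem_head is_partn_insert.
have /and3P[ss s0 /eqP sk] := sP; have pr := perm_to_rem ls.
exists (rem l s); last first.
  apply: (sorted_eq geq_trans geq_anti) => //.
    by rewrite sort_sorted //; apply: geq_total.
  by rewrite (perm_trans pr) // perm_sym perm_insert_part.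
rewrite mem_partns /is_partn (subseq_sorted geq_trans (rem_subseq _ _) ss) /=.
move: s0 sk; rewrite (perm_all _ pr) (perm_sumn pr) /= => /andP[_ ->] <-.
by rewrite addKn eqxx.
Qed.

Variable W : nat -> {poly rat}.

(** The weighted count of set partitions of a k-set: k! times the coefficient of z^k in exp(sum_{l
    >= 1} W_l z^l / l!). *)
Definition partn_sum k : {poly rat} :=
  \sum_(s <- partns k) pi_partn s *: \prod_(x <- s) W x.

Lemma partn_sum0 : partn_sum 0 = 1.
Proof.
rewrite /partn_sum (perm_big [:: [::]]) /=; last first.
  apply: uniq_perm; rewrite ?partns_uniq // => s; rewrite mem_partns inE /is_partn.
  case: s => //= x s; case: x => [|x]; rewrite ?andbF //.
rewrite big_seq1 big_nil /pi_partn /= !big_nil.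
by rewrite !invr1 !mulr1 scale1r.
Qed.

(** The parts add up to [k], so [k] is the sum of [l] times the multiplicity of [l]; the
    multiplicity marks a part, which [pi_partn_cons] then splits off. *)
Lemma partn_sum_rec k :
  k%:R *: partn_sum k =
  \sum_(l < k.+1) (l * 'C(k, l))%:R *: (W l * partn_sum (k - l)).
Proof.
rewrite /partn_sum scaler_sumr.
transitivity (\sum_(s <- partns k) \sum_(l < k.+1)
  (l * count_mem (l : nat) s)%:R *: (pi_partn s *: \prod_(x <- s) W x)).
  apply: eq_big_seq => s; rewrite mem_partns => sP.
  rewrite -scaler_suml -natr_sum -sumn_count ?is_partn_le //.
  by case/and3P: sP => _ _ /eqP ->.
rewrite exchange_big /=; apply: eq_bigr => l _.
case: (posnP l) => [->|l0].
  by rewrite mul0n scale0r big1 // => s _; rewrite mul0n scale0r.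
have lk : (0 < l <= k)%N by rewrite l0 -ltnS ltn_ord.
rewrite (bigID (fun s : seq nat => (l : nat) \in s)) /= addrC big1 ?add0r; last first.
  by move=> s ls; rewrite (count_memPn ls) muln0 scale0r.
rewrite -big_filter (perm_big _ (partns_insert lk)) big_map /=.
rewrite mulr_sumr scaler_sumr; apply: eq_big_seq => s; rewrite mem_partns => sP.
have st := perm_insert_part l s.
rewrite (seq.permP st) (perm_pi_partn st) (perm_big _ st) big_cons /= scalerA natrM.
rewrite -mulrA [_ * pi_partn _]mulrC (pi_partn_cons sP) /=; last by case/andP: lk.
by rewrite natrM mulrA -scalerA scalerAr.
Qed.

End PartitionRecurrence.

(** * Cycle decomposition *)

Section PermutationOrbits.
Variable T : finType.
Implicit Types (s t u v w : {perm T}) (C D S : {set T}) (x y : T).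
Local Open Scope group_scope.

Lemma porbit_stable s x y : (s y \in porbit s x) = (y \in porbit s x).
Proof.
by rewrite -!eq_porbit_mem; have := porbit_perm s 1 y; rewrite expg1 => ->.
Qed.

Lemma eq_in_porbit s t x : {in porbit s x, s =1 t} -> porbit t x = porbit s x.
Proof.
move=> st; have e i : (t ^+ i) x = (s ^+ i) x.
  elim: i => [|i IH]; first by rewrite !expg0.
  by rewrite !expgSr !permM IH st ?mem_porbit.
by apply/setP => y; apply/porbitP/porbitP => -[i ->]; exists i; rewrite e.
Qed.

Lemma porbit_fixed s x : s x = x -> porbit s x = [set x].
Proof.
move=> sx; apply/setP => y; rewrite inE; apply/idP/eqP => [/porbitP[i ->]|->].
  by elim: i => [|i IH]; rewrite ?expg0 ?perm1 // expgSr permM IH.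
exact: porbit_id.
Qed.

Lemma porbit_subset S s x : perm_on S s -> x \in S -> porbit s x \subset S.
Proof.
move=> sS xS; apply/subsetP => y /porbitP[i ->].
by elim: i => [|i IH]; rewrite ?expg0 ?perm1 // expgSr permM perm_closed.
Qed.

Lemma porbits_eq s C x : C \in porbits s -> x \in C -> C = porbit s x.
Proof. by case/imsetP=> y _ -> xy; apply/esym/eqP; rewrite eq_porbit_mem. Qed.

Lemma porbits_porbit s x : porbit s x \in porbits s.
Proof. exact: imset_f. Qed.

Lemma mem_astabs_perm s C : (forall y, y \in C -> s y \in C) -> s \in 'N(C | 'P).
Proof.
by move=> sC; rewrite !inE /=; apply/subsetP => y yC; rewrite inE /= apermE sC.
Qed.

Lemma perm_on_set0 s : perm_on set0 s = (s == 1).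
Proof.
apply/idP/eqP => [s0|->]; last exact: perm_on1.
by apply: (perm_on_id s0); rewrite cards0.
Qed.

Definition cyclic_on C : pred {perm T} := fun u => perm_on C u && (C \in porbits u).

End PermutationOrbits.

Section CycleDecomposition.
Variables (T : finType) (R : comNzRingType) (H : {set T} -> {perm T} -> R).
Hypothesis H_local : forall (C : {set T}) (s t : {perm T}), {in C, s =1 t} -> H C s = H C t.
Implicit Types (s t u v w : {perm T}) (C D S : {set T}) (x y : T).
Local Open Scope ring_scope.

(** The condition [C \subset S] discards the trivial orbits of the points outside [S]. *)
Definition perm_sum S :=
  \sum_(w | perm_on S w) \prod_(C in porbits w | C \subset S) H C w.

Definition cycle_sum C := \sum_(u | cyclic_on C u) H C u.

Lemma perm_sum_set0 : perm_sum set0 = 1.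
Proof.
rewrite /perm_sum (eq_bigl _ _ (@perm_on_set0 T)) big_pred1_eq.
rewrite big1 // => C /andP[/imsetP[x _ ->]]; rewrite subset0 => /eqP e.
by have := porbit_id 1%g x; rewrite e inE.
Qed.

Section Split.
Variables (S C : {set T}) (x : T).
Hypotheses (xC : x \in C) (CS : C \subset S).

Lemma mul_disjointE u v : perm_on C u -> perm_on (S :\: C) v ->
  {in C, (u * v)%g =1 u} * {in ~: C, (u * v)%g =1 v}.
Proof.
move=> uC vS; split=> y yC; rewrite permM.
  by rewrite (out_perm vS) // !inE perm_closed // yC.
by rewrite inE in yC; rewrite (out_perm uC).
Qed.

Lemma cyclic_on_factor u v : perm_on C u -> perm_on (S :\: C) v ->
  porbit (u * v)%g x = C -> cyclic_on C u.
Proof.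
move=> uC vS pC; have [euv _] := mul_disjointE uC vS.
rewrite /cyclic_on uC -(_ : porbit u x = C) ?porbits_porbit //.
by rewrite -[RHS]pC; apply: eq_in_porbit => z; rewrite pC => zC; rewrite euv.
Qed.

Lemma porbits_mul_disjoint u v : cyclic_on C u -> perm_on (S :\: C) v ->
  [set D in porbits (u * v)%g | D \subset S] =
  C |: [set D in porbits v | D \subset S :\: C].
Proof.
move=> /andP[uC Cu] vS; have [eu ev] := mul_disjointE uC vS.
have CE := porbits_eq Cu.
have pC y : y \in C -> porbit (u * v)%g y = C.
  move=> yC; rewrite (CE _ yC); apply: eq_in_porbit => z; rewrite -(CE _ yC) => zC.
  by rewrite eu.
have pNC y : y \in S :\: C -> porbit (u * v)%g y = porbit v y.
  move=> yS; apply: eq_in_porbit => z /(subsetP (porbit_subset vS yS)).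
  by rewrite inE => /andP[zC _]; rewrite ev // inE.
apply/setP => D; rewrite !inE; apply/andP/orP.
  case=> /imsetP[y _ ->{D}] yS.
  have {}yS' := subsetP yS _ (porbit_id _ y).
  have [yC|yC] := boolP (y \in C); first by left; rewrite pC.
  right; have ySC : y \in S :\: C by rewrite inE yC.
  by rewrite pNC // porbits_porbit porbit_subset.
case=> [/eqP ->|/andP[/imsetP[y _ ->{D}] yS]].
  by rewrite CS -(pC x) // porbits_porbit.
have ySC := subsetP yS _ (porbit_id _ y).
by rewrite -pNC // porbits_porbit /= pNC // (subset_trans yS) // subsetDl.
Qed.

(** Such a [w] is uniquely a product of its restrictions to [C] and to [S :\: C], and by locality of
    [H] each orbit weight sees only one of the two factors. *)
Lemma perm_sum_split :
  \sum_(w | perm_on S w && (porbit w x == C))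
     \prod_(D in porbits w | D \subset S) H D w =
  cycle_sum C * perm_sum (S :\: C).
Proof.
rewrite /cycle_sum /perm_sum big_distrlr /= pair_big /=.
rewrite (reindex_onto (fun p : {perm T} * {perm T} => (p.1 * p.2)%g)
   (fun w => (restr_perm C w, restr_perm (S :\: C) w))) /=; last first.
  move=> w /andP[wS /eqP wC].
  have nC : w \in ('N(C | 'P))%g.
    by apply: mem_astabs_perm => y; rewrite -wC porbit_stable.
  have nSC : w \in ('N(S :\: C | 'P))%g.
    by apply: mem_astabs_perm => y; rewrite -wC !inE porbit_stable perm_closed.
  apply/permP => y; rewrite permM.
  have [yC|yC] := boolP (y \in C).
    rewrite (restr_permE nC yC) (out_perm (restr_perm_on _ _)) //.
    by rewrite in_setD -wC porbit_stable wC yC.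
  rewrite (out_perm (restr_perm_on C _)) //.
  have [yS|yS] := boolP (y \in S); first by rewrite restr_permE // inE yC.
  rewrite (out_perm (restr_perm_on _ _)) ?inE ?yC //.
  by rewrite (out_perm wS).
apply: eq_big => [[u v]|[u v] /=].
  rewrite /=; apply/idP/idP; last first.
    case/andP=> uC vS; have /andP[uC1 Cu] := uC; have [eu ev] := mul_disjointE uC1 vS.
    have CE := porbits_eq Cu xC.
    have pC : porbit (u * v)%g x = C.
      by rewrite CE; apply: eq_in_porbit => z; rewrite -CE => zC; rewrite eu.
    have onS : perm_on S (u * v)%g.
      apply: perm_onM; first exact: subset_trans uC1 CS.
      exact: subset_trans vS (subsetDl _ _).
    rewrite onS pC eqxx /=; apply/eqP; congr (_, _); apply/permP => y.
      have [yC|yC] := boolP (y \in C).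
        rewrite restr_permE ?eu //; apply: mem_astabs_perm => z zC.
        by rewrite eu ?perm_closed.
      by rewrite (out_perm (restr_perm_on _ _)) // (out_perm uC1).
    have [yC|yC] := boolP (y \in S :\: C).
      rewrite restr_permE ?ev //.
        by move: yC; rewrite !inE => /andP[].
      apply: mem_astabs_perm => z zC.
      by rewrite ev ?perm_closed //; move: zC; rewrite !inE => /andP[].
    by rewrite (out_perm (restr_perm_on _ _)) // (out_perm vS).
  case/andP=> /andP[uvS /eqP pC] /eqP[eu ev].
  have vS : perm_on (S :\: C) v by rewrite -ev restr_perm_on.
  have uC : perm_on C u by rewrite -eu restr_perm_on.
  by rewrite vS (cyclic_on_factor uC vS pC).
case/andP=> /andP[uvS /eqP pC] /eqP[eu ev].
have vS : perm_on (S :\: C) v by rewrite -ev restr_perm_on.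
have uC : perm_on C u by rewrite -eu restr_perm_on.
have [euv evu] := mul_disjointE uC vS.
have cu := cyclic_on_factor uC vS pC.
rewrite (eq_bigl [in [set D in porbits (u * v)%g | D \subset S]]); last first.
  by move=> D; rewrite !inE.
rewrite (porbits_mul_disjoint cu vS) big_setU1 /=; last first.
  rewrite !inE; apply/negP => /andP[_ /subsetP /(_ x xC)].
  by rewrite inE xC.
congr (_ * _); first by apply: H_local.
apply: eq_big => [D|D]; first by rewrite !inE.
rewrite !inE => /andP[_ /subsetP DS]; apply: H_local => y /DS.
by rewrite !inE => /andP[yC _]; rewrite evu // inE.
Qed.

End Split.

Lemma perm_sum_peel S x : x \in S ->
  perm_sum S =
  \sum_(C : {set T} | (x \in C) && (C \subset S)) cycle_sum C * perm_sum (S :\: C).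
Proof.
move=> xS; rewrite {1}/perm_sum.
rewrite (partition_big (fun w => porbit w x)
  (fun C : {set T} => (x \in C) && (C \subset S))) /=; last first.
  by move=> w wS; rewrite porbit_id porbit_subset.
by apply: eq_bigr => C /andP[xC CS]; rewrite (perm_sum_split xC CS).
Qed.

(** Summing [perm_sum_peel] over all [x] in [S] counts each [C] once for each of its points. *)
Lemma perm_sum_rec S :
  #|S|%:R * perm_sum S =
  \sum_(C : {set T} | C \subset S) #|C|%:R * (cycle_sum C * perm_sum (S :\: C)).
Proof.
rewrite -sumr_const mulr_suml.
under eq_bigr => x xS do rewrite mul1r (perm_sum_peel xS).
rewrite (exchange_big_dep (fun C : {set T} => C \subset S)) /=; last by move=> x C _ /andP[].
apply: eq_bigr => C CS; rewrite -sumr_const [RHS]mulr_suml.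
apply: eq_big => [x|x _]; last by rewrite mul1r.
by rewrite CS andbT andb_idl // => /(subsetP CS).
Qed.

End CycleDecomposition.

(** Grouping the subsets [C] by size turns [perm_sum_rec] into [partn_sum_rec]; strong induction on
    the size of [S] then concludes. *)
Lemma perm_sum_partn_sum (T : finType) (H : {set T} -> {perm T} -> {poly rat})
    (W : nat -> {poly rat}) :
  (forall (C : {set T}) (s t : {perm T}), {in C, s =1 t} -> H C s = H C t) ->
  (forall C : {set T}, C != set0 -> cycle_sum H C = W #|C|) ->
  forall S, perm_sum H S = partn_sum W #|S|.
Proof.
move=> H_local cW S; move: {2}#|S| (leqnn #|S|) => N; elim: N S => [|N IH] S.
  rewrite leqn0 cards_eq0 => /eqP ->.
  by rewrite perm_sum_set0 cards0 partn_sum0.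
move=> SN; have [S0|S0] := eqVneq S set0.
  by rewrite S0 perm_sum_set0 cards0 partn_sum0.
have k0 : (#|S|%:R != 0 :> rat)%R by rewrite pnatr_eq0 cards_eq0.
apply: (scalerI k0); rewrite partn_sum_rec scaler_nat -mulr_natl perm_sum_rec //.
rewrite (partition_big (fun C : {set T} => inord #|C| : 'I_#|S|.+1) xpredT) //=.
apply: eq_bigr => l _.
have lS : l <= #|S| by rewrite -ltnS ltn_ord.
transitivity (\sum_(C in [set C : {set T} | C \subset S & #|C| == l])
    (l%:R * (W l * partn_sum W (#|S| - l))) : {poly rat})%R.
  apply: eq_big => [C|C].
    rewrite inE; apply: andb_id2l => /subset_leq_card CS.
    by rewrite -val_eqE /= inordK.
  move=> /andP[CS /eqP Cl]; have cC : #|C| = l.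
    by rewrite -Cl inordK // ltnS subset_leq_card.
  (* The empty block, on which [cW] says nothing, carries the factor 0. *)
  have [C0|C0] := eqVneq C set0.
    by rewrite -cC C0 cards0 !mul0r.
  rewrite cW // cC IH ?cardsDS ?cC //.
  by have : 0 < #|C| by [rewrite card_gt0]; lia.
rewrite sumr_const cards_draws mulr_natl -mulrnA.
by rewrite scaler_nat.
Qed.

(** * Excedances of cyclic permutations *)

Section CyclicOnInsertion.
Variable T : finType.
Implicit Types (u w : {perm T}) (C : {set T}) (x i : T).

Lemma card_porbits_perm_on C w : perm_on C w ->
  #|porbits w| = #|~: C| + #|porbit w @: C|.
Proof.
move=> wC; have -> : porbits w = (set1 @: ~: C) :|: (porbit w @: C).
  apply/setP => D; rewrite inE; apply/imsetP/orP => [[y _ ->]|[]].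
  - have [yC|yC] := boolP (y \in C); first by right; apply: imset_f.
    by left; rewrite porbit_fixed ?(out_perm wC) // imset_f // inE.
  - case/imsetP=> y yC ->; exists y => //; rewrite porbit_fixed //.
    by rewrite (out_perm wC) // -in_setC.
  by case/imsetP=> y yC ->; exists y.
have dis : (set1 @: ~: C) :&: (porbit w @: C) = set0.
  apply/setP => D; rewrite !inE; apply/andP => -[/imsetP[y yC ->] /imsetP[z zC e]].
  have : z \in [set y] by rewrite e porbit_id.
  by rewrite inE => /eqP zy; move: yC; rewrite inE -zy zC.
by rewrite cardsU dis cards0 subn0 card_imset //; apply: set1_inj.
Qed.

(** Reduces cyclicity to the number of orbits, whose change under multiplication by a transposition
    is known. *)
Lemma cyclic_on_card C w : C != set0 -> perm_on C w ->
  cyclic_on C w = (#|porbits w| == #|~: C|.+1).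
Proof.
case/set0Pn=> x xC wC; rewrite (card_porbits_perm_on wC) /cyclic_on wC /=.
rewrite -addn1 eqn_add2l; apply/idP/cards1P => [Cw|[D eD]].
  exists C; apply/setP => D; rewrite inE; apply/imsetP/eqP => [[y yC ->]|->].
    by rewrite -(porbits_eq Cw yC).
  by exists x => //; apply: porbits_eq.
have pD y : y \in C -> porbit w y = D.
  by move=> yC; apply/set1P; rewrite -eD imset_f.
rewrite (_ : C = porbit w x) ?porbits_porbit //.
apply/eqP; rewrite eqEsubset (porbit_subset wC xC) andbT.
by apply/subsetP => y yC; rewrite -eq_porbit_mem !pD.
Qed.

(** For [i] in [C] the transposition merges the fixed point [x] into the orbit of [i]; for [i = x]
    the point [x] stays fixed, apart from the nonempty [C]. *)
Lemma cyclic_on_insert C x i w : x \notin C -> C != set0 -> perm_on C w ->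
  i \in x |: C -> perm_on (x |: C) (tperm i x * w)%g ->
  cyclic_on (x |: C) (tperm i x * w)%g = (i \in C) && cyclic_on C w.
Proof.
move=> xC C0 wC iC uC; rewrite !cyclic_on_card //; last first.
  by apply/set0Pn; exists x; rewrite setU11.
have := porbits_mul_tperm w i x; rewrite /= porbit_fixed ?(out_perm wC) //.
have cC : #|~: C| = #|~: (x |: C)|.+1.
  by have := cardsC C; have := cardsC (x |: C); rewrite cardsU1 xC; lia.
rewrite cC inE; have [ix|ix] := eqVneq i x.
  rewrite /= ix (negPf xC) /= => e; apply/negbTE.
  move: e; rewrite doubleE (card_porbits_perm_on wC) cC !addn0 => ->.
  have : 0 < #|porbit w @: C|.
    by have /set0Pn[y yC] := C0; apply/card_gt0P; exists (porbit w y); apply: imset_f.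
  lia.
have -> : i \in C by move: iC; rewrite !inE (negPf ix).
by rewrite /=; lia.
Qed.

Lemma perm_on_insert C x i w : x \notin C -> i \in x |: C -> perm_on C w ->
  perm_on (x |: C) (tperm i x * w)%g.
Proof.
move=> xC iC wC; apply: perm_onM; last by apply: subset_trans wC (subsetUr _ _).
apply: subset_trans (tperm_on _ _) _.
by apply/subsetP => y; rewrite !inE => /orP[]/eqP->; rewrite ?eqxx //; move: iC; rewrite !inE.
Qed.

(** Each [u] arises once, by placing [x] between [i], the preimage of [x] under [u], and [w i]; the
    choice [i = x] keeps [x] fixed. *)
Lemma sum_perm_on_insert (R : nmodType) (F : {perm T} -> R) C x : x \notin C ->
  (\sum_(u | perm_on (x |: C) u) F u =
   \sum_(i in x |: C) \sum_(w | perm_on C w) F (tperm i x * w)%g)%R.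
Proof.
move=> xC; rewrite pair_big /=.
rewrite (reindex_onto (fun p : T * {perm T} => tperm p.1 x * p.2)%g
   (fun u => (u^-1 x, tperm (u^-1 x) x * u)%g)) /=; last first.
  by move=> u _; rewrite tpermKg.
apply: eq_bigl => -[i w] /=; apply/idP/idP.
  case/andP=> uC /eqP[]; rewrite invMg tpermV permM => ei ew.
  have wx : w x = x.
    have : tperm i x (tperm i x (w^-1 x))%g = tperm i x i by rewrite ei.
    by rewrite tpermK tpermL => e; rewrite -{1}e permKV.
  have ui : (tperm i x * w)%g i = x by rewrite permM tpermL.
  have iC : i \in x |: C.
    have [->|ne] := eqVneq i x; first by rewrite setU11.
    by apply: (subsetP uC); rewrite inE /= ui eq_sym.
  rewrite iC /=; apply/subsetP => y; rewrite inE /= => wy.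
  have yx : y != x by apply: contraNneq wy => ->; rewrite wx.
  suff : y \in x |: C by rewrite inE inE (negPf yx).
  have [->//|yi] := eqVneq y i.
  by apply: (subsetP uC); rewrite inE /= permM tpermD // eq_sym.
case/andP=> iC wC; have wx : w x = x by rewrite (out_perm wC).
have wVx : (w^-1)%g x = x by rewrite -{1}wx permK.
rewrite invMg tpermV permM wVx tpermR tpermKg eqxx andbT.
exact: perm_on_insert.
Qed.

End CyclicOnInsertion.

Section Excedances.
Variable n : nat.
Implicit Types (u w : 'S_n) (C : {set 'I_n}) (x i : 'I_n).

Lemma exc_sum w : exc w = \sum_(i < n) (i < w i).
Proof.
rewrite /exc -sum1_card big_mkcond /=; apply: eq_bigr => i _.
by rewrite inE; case: ltnP.
Qed.

Lemma exc_sum_on C w : perm_on C w -> exc w = \sum_(i in C) (i < w i).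
Proof.
move=> wC; rewrite exc_sum (bigID [in C]) /= addnC big1 // => i iC.
by rewrite (out_perm wC) // ltnn.
Qed.

(** The point [i] now goes to the maximum [x], so it is an excedance, while [x] is not one; this is
    a gain unless [i] was an excedance before. *)
Lemma exc_insert C x i w : (forall y, y \in C -> y < x) -> i \in C -> perm_on C w ->
  exc (tperm i x * w)%g = exc w + ~~ (i < w i).
Proof.
move=> Cx iC wC; have ix : i < x := Cx _ iC.
have nix : x != i by apply: contraTneq ix => ->; rewrite ltnn.
have wx : w x = x by apply: (out_perm wC); apply/negP => /Cx; rewrite ltnn.
rewrite !exc_sum (bigD1 i) //= (bigD1 x) //= [in RHS](bigD1 i) //= [in RHS](bigD1 x) //=.
rewrite !permM tpermL tpermR wx ix ltnn.
have -> : (x < w i) = false.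
  by apply/negbTE; rewrite -leqNgt ltnW // Cx // perm_closed.
rewrite (eq_bigr (fun j : 'I_n => (j < w j) : nat)); last first.
  by move=> j /andP[ji jx]; rewrite permM tpermD // eq_sym.
by case: (i < w i); lia.
Qed.

End Excedances.

(** * Eulerian recurrences for all permutations and for cyclic ones *)

Section EulerianRecurrence.
Local Open Scope ring_scope.

(* Inserting a new maximum between [i] and [w i] creates an excedance unless
   [i < w i] already; [insert_op #|C|] sums ['X^(exc _)] over all [i] in [C]. *)
Definition insert_op (s : nat) (f : {poly rat}) : {poly rat} :=
  s%:R *: ('X * f) + ('X - 'X^2) * f^`().

Lemma insert_op_sum I (r : seq I) (P : pred I) s (F : I -> {poly rat}) :
  insert_op s (\sum_(i <- r | P i) F i) = \sum_(i <- r | P i) insert_op s (F i).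
Proof. by rewrite /insert_op mulr_sumr scaler_sumr raddf_sum mulr_sumr -big_split. Qed.

Lemma insert_opXn s e : insert_op s 'X^e = s%:R *: 'X^(e.+1) + e%:R *: ('X^e - 'X^(e.+1)).
Proof.
rewrite /insert_op -exprS derivXn; congr (_ + _).
case: e => [|e]; first by rewrite mulr0n mulr0 scale0r.
by rewrite scaler_nat mulrnAr /= mulrBl -exprS -exprD.
Qed.

Lemma sum_exc_insert n (C : {set 'I_n}) (x : 'I_n) (w : 'S_n) :
  (forall y, y \in C -> (y < x)%N) -> perm_on C w ->
  \sum_(i in C) 'X^(exc (tperm i x * w)%g) = insert_op #|C| 'X^(exc w).
Proof.
move=> Cx wC; rewrite insert_opXn.
transitivity (\sum_(i in C) ('X^((exc w).+1) +
   (i < w i)%N%:R *: ('X^(exc w) - 'X^((exc w).+1)) : {poly rat})).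
  apply: eq_bigr => i iC; rewrite (exc_insert Cx) //.
  by case: (i < w i)%N; rewrite ?addn0 ?addn1 ?scale1r ?scale0r ?addr0 //; ring.
rewrite big_split /= sumr_const -scaler_suml -natr_sum -(exc_sum_on wC).
by rewrite !scaler_nat.
Qed.

(** The derivative recurrence of the Eulerian polynomials: the first summand fixes the new maximum,
    the second inserts it after an older point. *)
Fixpoint euler_poly (s : nat) : {poly rat} :=
  if s is s'.+1 then euler_poly s' + insert_op s' (euler_poly s') else 1.

(** [exc_insert] controls only the insertion of a new maximum, so sets are built up in increasing
    order. *)
Lemma set_max_ind n (P : {set 'I_n} -> Prop) :
  P set0 ->
  (forall (C : {set 'I_n}) (x : 'I_n), (forall y, y \in C -> (y < x)%N) -> P C -> P (x |: C)) ->
  forall C, P C.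
Proof.
move=> P0 PU C; move: {2}#|C| (leqnn #|C|) => N; elim: N C => [|N IH] C.
  by rewrite leqn0 cards_eq0 => /eqP ->.
have [->//|/set0Pn[x0 x0C] CN] := eqVneq C set0.
case: (arg_maxnP (fun i : 'I_n => i : nat) x0C) => x xC0 xmax.
have xC : x \in C := xC0.
rewrite -(setD1K xC); apply: PU.
  move=> y; rewrite !inE => /andP[yx yC]; rewrite ltn_neqAle.
  by have /= -> := xmax y yC; rewrite andbT val_eqE.
by apply: IH; rewrite -ltnS (leq_trans _ CN) // [ltnRHS](cardsD1 x C) xC.
Qed.

Lemma sum_perm_on_exc n (C : {set 'I_n}) :
  \sum_(w | perm_on C w) 'X^(exc w) = euler_poly #|C|.
Proof.
elim/set_max_ind: C => [|C x Cx IH].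
  rewrite cards0 (eq_bigl _ _ (@perm_on_set0 _)) big_pred1_eq.
  by rewrite exc_sum big1 ?expr0 // => i _; rewrite perm1 ltnn.
have xC : x \notin C by apply/negP => /Cx; rewrite ltnn.
rewrite sum_perm_on_insert // big_setU1 //= cardsU1 xC /= -IH; congr (_ + _).
  by apply: eq_bigr => w _; rewrite tperm1 mul1g.
rewrite insert_op_sum exchange_big /=; apply: eq_bigr => w wC.
exact: sum_exc_insert.
Qed.

Lemma eulerianE s : eulerian s = euler_poly s.
Proof.
rewrite -[in RHS](card_ord s) -cardsT -sum_perm_on_exc; apply: eq_bigl => w.
by apply/esym/subsetP => i; rewrite inE.
Qed.

(** Pulling out ['X] turns the recurrence for cyclic permutations into that of [euler_poly], one
    index lower. *)
Lemma insert_opMX s f : insert_op s.+1 ('X * f) = 'X * (f + insert_op s f).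
Proof.
by rewrite /insert_op derivM derivX !scaler_nat; ring.
Qed.

(** In a cycle on more than one point the maximum is not fixed, so only the insertions after points
    of [C] remain. *)
Lemma sum_cyclic_on_insert n (C : {set 'I_n}) (x : 'I_n) :
  (forall y, y \in C -> (y < x)%N) -> C != set0 ->
  \sum_(u | cyclic_on (x |: C) u) 'X^(exc u) =
  insert_op #|C| (\sum_(w | cyclic_on C w) 'X^(exc w)).
Proof.
move=> Cx C0; have xC : x \notin C by apply/negP => /Cx; rewrite ltnn.
transitivity (\sum_(u | perm_on (x |: C) u)
   (if cyclic_on (x |: C) u then 'X^(exc u) else 0 : {poly rat})).
  rewrite -big_mkcondr; apply: eq_bigl => u; rewrite andb_idl //.
  by case/andP.
rewrite sum_perm_on_insert // insert_op_sum.
under eq_bigr => i iC.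
  under eq_bigr => w wC do
    rewrite (cyclic_on_insert xC C0 wC iC (perm_on_insert xC iC wC)).
  over.
rewrite big_setU1 //= big1 ?add0r; last by move=> w wC; rewrite (negPf xC).
rewrite exchange_big /= [RHS]big_mkcond /= [LHS]big_mkcond /=; apply: eq_bigr => w _.
rewrite {2}/cyclic_on; case: (boolP (perm_on C w)) => //= wC.
have -> : cyclic_on C w = (C \in porbits w) by rewrite /cyclic_on wC.
case: ifP => Cw; last by rewrite big1 // => i _; rewrite andbF.
by rewrite -(sum_exc_insert Cx) //; apply: eq_bigr => i iC; rewrite iC.
Qed.

Lemma sum_cyclic_on_exc1 n (C : {set 'I_n}) : #|C| = 1%N ->
  \sum_(u | cyclic_on C u) 'X^(exc u) = 1 :> {poly rat}.
Proof.
move=> c1; have /cards1P[y Cy] : #|C| == 1%N by rewrite c1.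
rewrite (big_pred1 1%g) => [|w]; last first.
  rewrite /cyclic_on; apply/andP/eqP => [[wC _]|->].
    by apply: (perm_on_id wC); rewrite c1.
  split; first exact: perm_on1.
  by rewrite Cy -(porbit_fixed (perm1 y)) porbits_porbit.
by rewrite exc_sum big1 => [|i _]; rewrite ?expr0 // perm1 ltnn.
Qed.

(* Both sides satisfy the recurrence obtained by inserting the largest element.
   A fixed point is not an excedance, so the identity fails for [#|C| = 1]. *)
Lemma sum_cyclic_on_exc n (C : {set 'I_n}) : (1 < #|C|)%N ->
  \sum_(u | cyclic_on C u) 'X^(exc u) = 'X * eulerian #|C|.-1.
Proof.
rewrite eulerianE; elim/set_max_ind: C => [|C x Cx IH]; first by rewrite cards0.
have xC : x \notin C by apply/negP => /Cx; rewrite ltnn.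
rewrite cardsU1 xC add1n ltnS => C0; rewrite sum_cyclic_on_insert -?card_gt0 //.
have [C1|C1] := ltnP 1 #|C|.
  rewrite IH //; case: #|C| C1 => // -[//|c] _ /=.
  exact: insert_opMX.
have {C0 C1} c1 : #|C| = 1%N by lia.
rewrite c1 /= sum_cyclic_on_exc1 // /insert_op derivC.
by rewrite !scale0r scale1r !mulr0 mulr1 !addr0 mulr1.
Qed.

End EulerianRecurrence.

(** * Cycle weights *)

Section CycleWeights.
Local Open Scope ring_scope.

Section SelectExponents.
Variable p : pred nat.
Implicit Types f : {poly rat}.

Definition sel f : {poly rat} := \poly_(i < size f) (if p i then f`_i else 0).

Lemma coef_sel f i : (sel f)`_i = if p i then f`_i else 0.
Proof.
by rewrite coef_poly; case: ltnP => // fi; rewrite [f`_i]nth_default // if_same.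
Qed.

Lemma sel_sum I (s : seq I) (P : pred I) (F : I -> {poly rat}) :
  sel (\sum_(i <- s | P i) F i) = \sum_(i <- s | P i) sel (F i).
Proof.
apply/polyP => j; rewrite coef_sel !coef_sum; case: ifP => pj.
  by apply: eq_bigr => i _; rewrite coef_sel pj.
by rewrite big1 // => i _; rewrite coef_sel pj.
Qed.

Lemma selXn e : sel 'X^e = if p e then 'X^e else 0.
Proof.
apply/polyP => j; rewrite coef_sel coefXn; case: (eqVneq j e) => [->|ne].
  by case: ifP; rewrite ?coefXn ?eqxx ?coef0.
by rewrite if_same; case: ifP; rewrite ?coefXn ?(negPf ne) ?coef0.
Qed.

Lemma sel_eq0 f : (forall i, p i = false) -> sel f = 0.
Proof. by move=> p0; apply/polyP => i; rewrite coef_sel p0 coef0. Qed.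

End SelectExponents.

Lemma eq_sel p q f : p =1 q -> sel p f = sel q f.
Proof. by move=> pq; apply/polyP => i; rewrite !coef_sel pq. Qed.

Lemma gcd_partE f b c : gcd_part f b c = sel (fun i => gcdn i b == c) f.
Proof.
rewrite /gcd_part /sel poly_def big_mkcond; apply: eq_bigr => i _.
by case: ifP => _; rewrite ?scale0r.
Qed.

(** Distributivity: the orbits partition [T], so functions chosen on each orbit, with default [j0]
    off it, glue to a single function on [T]. *)
Lemma prod_porbits_sum (T J : finType) (j0 : J) (R : comNzRingType) (w : {perm T})
    (g : {set T} -> {ffun T -> J} -> R) :
  (forall (C : {set T}) (b b' : {ffun T -> J}), {in C, b =1 b'} -> g C b = g C b') ->
  \prod_(C in porbits w) \sum_(b in pfamily j0 [in C] (fun=> predT)) g C b =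
  \sum_b \prod_(C in porbits w) g C b.
Proof.
move=> g_local; pose b0 : {ffun T -> J} := [ffun=> j0].
rewrite (big_distr_big_dep b0) /=.
(* [h] cuts [b] along the orbits; [b0] is the default imposed at sets that are not orbits. *)
pose h (b : {ffun T -> J}) : {ffun {set T} -> {ffun T -> J}} :=
  [ffun C => if C \in porbits w then [ffun j => if j \in C then b j else j0] else b0].
rewrite (reindex_onto h (fun F => [ffun j => F (porbit w j) j])) /=; last first.
  move=> F /pfamilyP[/supportP Fsupp Fin]; apply/ffunP => C; rewrite ffunE.
  case: ifP => Cw; last by rewrite Fsupp // Cw.
  apply/ffunP => j; rewrite !ffunE; case: ifP => jC.
    by rewrite -(porbits_eq Cw jC).
  by have /pfamilyP[/supportP -> //] := Fin _ Cw; rewrite jC.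
apply: eq_big => [b|b _].
  rewrite andbC; apply/andP; split.
    by apply/eqP/ffunP => j; rewrite !ffunE porbits_porbit ffunE porbit_id.
  apply/pfamilyP; split; first by apply/supportP => C Cw; rewrite ffunE (negPf Cw).
  move=> C Cw; rewrite ffunE Cw; apply/pfamilyP; split=> //.
  by apply/supportP => j jC; rewrite ffunE (negPf jC).
apply: eq_bigr => C Cw; apply: g_local => j jC.
by rewrite !ffunE Cw ffunE jC.
Qed.

Section Weights.
Variables (r d : nat).

(* A cycle of length [l] in S_k with [s] excedances above it lifts to cycles of
   length [l * d / gcdn s d], which must equal [r]. *)
Definition lift_ok (l s : nat) : bool := (l * d == r * gcdn s d)%N.

Definition weight (f : {poly rat}) (l : nat) : {poly rat} :=
  sel (lift_ok l) (f * tbracket d ^+ l).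

Definition part_weight (l : nat) := weight ('X * eulerian l.-1) l.

(* The number of excedances of the lifted permutation among the [d] points
   above [j]: it ranges over [1, d] if [j < w j], and over [0, d - 1] otherwise. *)
Definition excs k (w : 'S_k) (b : {ffun 'I_k -> 'I_d}) (j : 'I_k) : nat :=
  (b j + (j < w j))%N.

(** The excedances are counted inside [C] only, so that the weight depends on [w] only through its
    values on [C]. *)
Definition cycle_weight k (C : {set 'I_k}) (w : 'S_k) : {poly rat} :=
  weight 'X^(\sum_(j in C) (j < w j))%N #|C|.

Lemma cycle_weight_local k (C : {set 'I_k}) (s t : 'S_k) :
  {in C, s =1 t} -> cycle_weight C s = cycle_weight C t.
Proof.
move=> st; rewrite /cycle_weight; congr (weight _ _); congr ('X^_).
by apply: eq_bigr => j jC; rewrite st.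
Qed.

Hypothesis d_gt0 : (0 < d)%N.

(** Expanding the power of [tbracket d] picks an exponent [b j < d] for each [j] in [C]. *)
Lemma cycle_weightE k (C : {set 'I_k}) (w : 'S_k) :
  cycle_weight C w =
  \sum_(b in pfamily (Ordinal d_gt0) [in C] (fun=> predT))
    if lift_ok #|C| (\sum_(j in C) excs w b j)%N
    then 'X^(\sum_(j in C) excs w b j)%N else 0.
Proof.
rewrite /cycle_weight /weight -prodr_const /tbracket.
rewrite (big_distr_big_dep (Ordinal d_gt0)) /= mulr_sumr sel_sum.
apply: eq_bigr => b _.
by rewrite prodrXr -exprD -big_split selXn /= (eq_bigr _ (fun j _ => addnC _ _)).
Qed.

Lemma perm_sum_cycle_weight k :
  perm_sum (@cycle_weight k) setT =
  \sum_(w : 'S_k) \sum_(b : {ffun 'I_k -> 'I_d})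
    if [forall C in porbits w, lift_ok #|C| (\sum_(j in C) excs w b j)%N]
    then 'X^(\sum_j excs w b j)%N else 0.
Proof.
rewrite /perm_sum; apply: eq_big => [w|w _].
  by apply/subsetP => i; rewrite inE.
rewrite (eq_bigl [in porbits w]); last by move=> C; rewrite subsetT andbT.
under eq_bigr => C _ do rewrite cycle_weightE.
rewrite (prod_porbits_sum (Ordinal d_gt0)); last first.
  move=> C b b' bb; rewrite (eq_bigr (excs w b')) // => j jC.
  by rewrite /excs bb.
apply: eq_bigr => b _; case: ifPn => [/forall_inP ok|].
  under eq_bigr => C Cw do rewrite ok //.
  rewrite prodrXr; congr ('X^_); rewrite [RHS](partition_big_imset (porbit w)) /=.
  apply: eq_big => // C Cw; apply: eq_bigl => j; apply/idP/eqP => [jC|<-]; last exact: porbit_id.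
  by rewrite -(porbits_eq Cw jC).
rewrite negb_forall => /existsP[C]; rewrite negb_imply => /andP[Cw nok].
by rewrite (bigD1 C) //= (negPf nok) mul0r.
Qed.

Hypothesis r_gt1 : (1 < r)%N.

Lemma cycle_sum_weight k (C : {set 'I_k}) : C != set0 ->
  cycle_sum (@cycle_weight k) C = part_weight #|C|.
Proof.
rewrite -card_gt0 => C0; rewrite /cycle_sum /part_weight /cycle_weight /weight.
transitivity (sel (lift_ok #|C|)
    ((\sum_(u | cyclic_on C u) 'X^(exc u)) * tbracket d ^+ #|C|)).
  rewrite mulr_suml sel_sum; apply: eq_bigr => u /andP[uC _].
  by rewrite (exc_sum_on uC).
have [C1|C1] := ltnP 1 #|C|; first by rewrite sum_cyclic_on_exc.
have {C0 C1} c1 : #|C| = 1%N by apply/eqP; rewrite eqn_leq C1 C0.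
rewrite sum_cyclic_on_exc1 // c1 eulerianE /= mulr1 mul1r expr1.
(* For a singleton the two polynomials differ by ['X^d - 1]; the exponents 0 and [d] have gcd [d]
   with [d], so [lift_ok] would force [d = r * d]. *)
have e : 'X * tbracket d = tbracket d + 'X^d - 1.
  have <- : \sum_(i < d.+1) 'X^i = tbracket d + 'X^d by rewrite big_ord_recr.
  rewrite /tbracket big_ord_recl /= expr0 [1 + _]addrC addrK mulr_sumr.
  by apply: eq_bigr => i _; rewrite -exprS.
rewrite e; apply/polyP => j; rewrite !coef_sel coefB coefD coefXn coefC.
case: ifP => // jok; have {}jok : (1 * d = r * gcdn j d)%N := eqP jok.
have [j0|j0] := eqVneq j 0%N; first by move: jok; rewrite j0 gcd0n; nia.
have [jd|jd] := eqVneq j d; first by move: jok; rewrite jd gcdnn; nia.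
by rewrite addr0 subr0.
Qed.

Lemma perm_sum_weight_partn k :
  perm_sum (@cycle_weight k) setT = partn_sum part_weight k.
Proof.
rewrite (perm_sum_partn_sum (@cycle_weight_local k) (@cycle_sum_weight k)).
by rewrite cardsT card_ord.
Qed.

End Weights.

(** * Rescaling partitions of m to partitions of k *)

Section ScaledPartitions.
Variables (m d r k : nat).
Hypotheses (r_gt0 : (0 < r)%N) (d_gt0 : (0 < d)%N) (rm_dk : (r * m = d * k)%N).

Definition part_ok x := (x %| d)%N && (d %| r * x)%N.
(** Describes the image of [part_ok] under x -> (r/d) x; the preimage of [y] is y d / r. *)
Definition scaled_ok y := (r %| y * d)%N && ((y * d) %/ r %| d)%N.

Lemma scale_partE x : part_ok x -> (scale_part r d x * d = r * x)%N.
Proof. by case/andP=> _ /divnK. Qed.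

Lemma scale_part_ok x : part_ok x -> scaled_ok (scale_part r d x).
Proof.
move=> xok; rewrite /scaled_ok scale_partE // dvdn_mulr // mulKn //.
by case/andP: xok.
Qed.

Lemma scale_partK x : part_ok x -> ((scale_part r d x * d) %/ r = x)%N.
Proof. by move=> xok; rewrite scale_partE // mulKn. Qed.

Lemma unscale_ok y : scaled_ok y -> part_ok ((y * d) %/ r).
Proof. by case/andP=> h1 h2; rewrite /part_ok h2 mulnC divnK // dvdn_mull. Qed.

Lemma unscaleK y : scaled_ok y -> scale_part r d ((y * d) %/ r) = y.
Proof. by case/andP=> h1 h2; rewrite /scale_part mulnC divnK // mulnK. Qed.

Lemma sumn_scale s : all part_ok s -> (sumn (map (scale_part r d) s) * d = r * sumn s)%N.
Proof.
elim: s => /= [|x s IHs /andP[xok /IHs e]]; first by rewrite muln0.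
by rewrite mulnDl mulnDr e scale_partE.
Qed.

Lemma is_partn_scale s : all part_ok s ->
  is_partn m s -> is_partn k (map (scale_part r d) s).
Proof.
move=> sok /and3P[ss s0 /eqP sm]; apply/and3P; split.
- apply: (homo_sorted (f := scale_part r d) (e := geq)) ss => x y /= xy.
  by rewrite /scale_part leq_div2r // leq_mul2l xy orbT.
- apply/allP => y /mapP[x xs ->] /=; have := scale_partE (allP sok _ xs).
  by have /= := allP s0 _ xs; nia.
by apply/eqP; have := sumn_scale sok; rewrite sm rm_dk; nia.
Qed.

Lemma is_partn_unscale s : all scaled_ok s ->
  is_partn k s -> is_partn m [seq ((y * d) %/ r)%N | y <- s].
Proof.
move=> sok /and3P[ss s0 /eqP sk].
have tok : all part_ok [seq ((y * d) %/ r)%N | y <- s].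
  by apply/allP => x /mapP[y ys ->]; apply: unscale_ok; apply: (allP sok).
apply/and3P; split.
- apply: (homo_sorted (f := fun y => ((y * d) %/ r)%N) (e := geq)) ss => x y /= xy.
  by rewrite leq_div2r // leq_mul2r xy orbT.
- apply/allP => x /mapP[y ys ->] /=.
  have /andP[/divnK e _] := allP sok _ ys.
  by have /= := allP s0 _ ys; nia.
have := sumn_scale tok; rewrite -map_comp map_id_in ?sk => [|y ys /=]; last first.
  by rewrite unscaleK // (allP sok).
by move=> e; apply/eqP; nia.
Qed.

Lemma partns_scale :
  perm_eq [seq map (scale_part r d) s | s <- partns m & all part_ok s]
          [seq s <- partns k | all scaled_ok s].
Proof.
apply: uniq_perm; last 1 first.
- move=> t; rewrite mem_filter mem_partns; apply/mapP/andP => [[s]|[tok tP]].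
    rewrite mem_filter mem_partns => /andP[sok sP] ->; split; last exact: is_partn_scale.
    by apply/allP => y /mapP[x xs ->]; apply: scale_part_ok; apply: (allP sok).
  exists [seq ((y * d) %/ r)%N | y <- t].
    rewrite mem_filter mem_partns is_partn_unscale // andbT.
    by apply/allP => x /mapP[y ys ->]; apply: unscale_ok; apply: (allP tok).
  by rewrite -map_comp map_id_in // => y ys /=; rewrite unscaleK // (allP tok).
- rewrite map_inj_in_uniq ?filter_uniq ?partns_uniq // => s t.
  rewrite !mem_filter => /andP[sok _] /andP[tok _] e.
  have K u : all part_ok u ->
      [seq ((y * d) %/ r)%N | y <- map (scale_part r d) u] = u.
    by move=> uok; rewrite -map_comp map_id_in // => x xu /=; rewrite scale_partK // (allP uok).
  by rewrite -(K s) // e K.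
by rewrite filter_uniq // partns_uniq.
Qed.

(** For l = (r/d) x one has l d = r x, so [lift_ok l i] says exactly that gcd(i, d) = x. *)
Lemma part_weight_scale x : part_ok x ->
  gcd_part ('X * eulerian (scale_part r d x).-1 * tbracket d ^+ scale_part r d x) d x
  = part_weight r d (scale_part r d x).
Proof.
move=> xok; rewrite gcd_partE /part_weight /weight; apply: eq_sel => i.
by rewrite /lift_ok scale_partE // eqn_pmul2l // eq_sym.
Qed.

(** A surviving exponent [i] satisfies y d = r gcd(i, d), which makes y d / r a divisor of [d]. *)
Lemma part_weight_eq0 y : ~~ scaled_ok y -> part_weight r d y = 0.
Proof.
move=> nok; apply: sel_eq0 => i; apply: contraNF nok => /eqP e.
by rewrite /scaled_ok e dvdn_mulr // mulKn // dvdn_gcdr.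
Qed.

Lemma partn_sum_scale :
  \sum_(mu in Par m d r)
      pi_partn [seq scale_part r d x | x <- mu] *:
      \prod_(x <- mu)
        gcd_part ('X * eulerian (scale_part r d x).-1
                     * tbracket d ^+ scale_part r d x) d x
  = partn_sum (part_weight r d) k.
Proof.
rewrite /partn_sum [RHS](bigID (all scaled_ok)) /= [X in _ + X]big1 ?addr0; last first.
  move=> s /allPn[y ys yok]; rewrite (big_rem y) //= part_weight_eq0 //.
  by rewrite mul0r scaler0.
rewrite -[RHS]big_filter -(perm_big _ partns_scale) /= big_map big_filter.
rewrite /partns big_map big_enum_cond /=; apply: eq_big => [mu|mu].
  by rewrite inE.
rewrite inE => muok; congr (_ *: _); rewrite big_map; apply: eq_big_seq => x xmu.
by rewrite part_weight_scale //; apply: (allP muok).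
Qed.

End ScaledPartitions.

End CycleWeights.

(** * The centralizer *)

Section OrbitLengths.
Variable T : finType.
Implicit Types (s : {perm T}) (x : T).

Lemma permX_porbitM s x q j : (s ^+ (#|porbit s x| * q + j))%g x = (s ^+ j)%g x.
Proof.
rewrite expgD permM; congr (_ _); elim: q => [|q IH]; first by rewrite muln0 perm1.
by rewrite mulnS addnC expgD permM IH permX iter_porbit.
Qed.

Lemma permX_fixed s x j : ((s ^+ j)%g x == x) = (#|porbit s x| %| j).
Proof.
have c0 : 0 < #|porbit s x| by rewrite lt0n card_porbit_neq0.
rewrite {1}(divn_eq j #|porbit s x|) mulnC permX_porbitM /dvdn.
have : j %% #|porbit s x| < #|porbit s x| by rewrite ltn_pmod.
move: (j %% _) => t tc; rewrite -[in RHS](@nth_uniq _ x (traject s x #|porbit s x|)) //;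
  rewrite ?size_traject ?uniq_traject_porbit //.
by rewrite !nth_traject // permX.
Qed.

Lemma sum_porbit s x (F : T -> nat) :
  \sum_(y in porbit s x) F y = \sum_(j < #|porbit s x|) F ((s ^+ j)%g x).
Proof.
rewrite (eq_bigl _ _ (porbit_traject s x)) -big_uniq ?uniq_traject_porbit //=.
rewrite (big_nth x) size_traject big_mkord; apply: eq_bigr => j _.
by rewrite nth_traject // permX.
Qed.

Lemma sum_porbitM s x (F : T -> nat) q :
  \sum_(j < #|porbit s x| * q) F ((s ^+ j)%g x) = q * \sum_(y in porbit s x) F y.
Proof.
elim: q => [|q IH]; first by rewrite muln0 mul0n big_ord0.
rewrite mulnSr big_split_ord /= IH mulSn addnC; congr (_ + _).
by rewrite sum_porbit; apply: eq_bigr => j _; rewrite permX_porbitM.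
Qed.

End OrbitLengths.

(** The additive order of [c] modulo [d] is d / gcd(c, d). *)
Lemma dvdn_mul_gcd d c q : 0 < d -> (d %| q * c) = (d %/ gcdn c d %| q).
Proof.
move=> d0; have g0 : 0 < gcdn c d by rewrite gcdn_gt0 d0 orbT.
have dE := divnK (dvdn_gcdr c d); have cE := divnK (dvdn_gcdl c d).
transitivity (d %/ gcdn c d * gcdn c d %| q * (c %/ gcdn c d * gcdn c d)).
  by rewrite dE cE.
rewrite mulnA dvdn_pmul2r // Gauss_dvdl //.
by rewrite /coprime -(eqn_pmul2r g0) muln_gcdl mul1n dE cE gcdnC.
Qed.

(** Once all cycles have length [r], their number is forced by [n = r * m]. *)
Lemma cycle_type_rect n r m (s : 'S_n) : 0 < r -> n = r * m ->
  (cycle_type s == nseq m r) = [forall p, #|porbit s p| == r].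
Proof.
move=> r0 n_rm; apply/eqP/forallP => [ct p|all_r].
  have : #|porbit s p| \in cycle_type s.
    by rewrite mem_sort; apply/imageP; exists (porbit s p); rewrite ?porbits_porbit.
  by rewrite ct mem_nseq => /andP[].
have cr C : C \in porbits s -> #|C| = r.
  by case/imsetP=> p _ ->; apply/eqP.
have cm : #|porbits s| = m.
  have : n = #|porbits s| * r.
    rewrite -[LHS](card_ord n) -[LHS]sum1_card.
    rewrite (partition_big_imset (porbit s)) /=.
    rewrite -sum_nat_const; apply: eq_big => // C Cs; rewrite -(cr _ Cs) -sum1_card.
    apply: eq_bigl => p; apply/eqP/idP => [<-|pC]; first exact: porbit_id.
    by rewrite -(porbits_eq Cs pC).
  by move: n_rm r0; nia.
have /all_pred1P -> : all (pred1 r) (cycle_type s).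
  apply/allP => c; rewrite mem_sort => /imageP[C Cs ->] /=.
  by rewrite cr.
by rewrite size_sort size_map -cardE cm.
Qed.

Lemma gammaX n j (i : 'I_n) : (gamma n ^+ j)%g i = (i + j) %% n :> nat.
Proof.
elim: j => [|j IH]; first by rewrite expg0 perm1 addn0 modn_small.
by rewrite expgSr permM permE /= IH -addn1 modnDml addn1 addnS.
Qed.

(** * Explicit parametrisation of the centralizer *)

Section Centralizer.
Variables (d k : nat).
Hypotheses (d_gt0 : 0 < d) (k_gt0 : 0 < k).
Local Notation n := (d * k).

(* [grid i a] is the point [i + k a]; [gamma n ^+ k] shifts the row [a]. *)
Lemma grid_subproof (i : 'I_k) a : i + k * (a %% d) < n.
Proof. by have := ltn_ord i; have := ltn_pmod a d_gt0; nia. Qed.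

Definition grid (i : 'I_k) a : 'I_n := Ordinal (grid_subproof i a).
Definition col (p : 'I_n) : 'I_k := Ordinal (ltn_pmod p k_gt0).

Lemma col_grid i a : col (grid i a) = i.
Proof. by apply: val_inj; rewrite /= mulnC addnC modnMDl modn_small. Qed.

Lemma row_grid i a : grid i a %/ k = a %% d.
Proof. by rewrite /= addnC mulnC divnMDl // divn_small ?addn0. Qed.

Lemma row_lt (p : 'I_n) : p %/ k < d.
Proof. by rewrite ltn_divLR. Qed.

Lemma gridK p : grid (col p) (p %/ k) = p.
Proof. by apply: val_inj; rewrite /= (modn_small (row_lt p)) addnC mulnC -divn_eq. Qed.

Lemma eq_grid i a i' a' :
  (grid i a == grid i' a') = (i == i') && (a == a' %[mod d]).
Proof.
apply/eqP/andP => [e|[/eqP-> /eqP e]]; last by apply: val_inj; rewrite /= e.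
by rewrite -(col_grid i a) -(row_grid i a) e col_grid row_grid.
Qed.

Lemma gammaX_grid j i a : ((gamma n ^+ k) ^+ j)%g (grid i a) = grid i (a + j).
Proof.
apply: val_inj; rewrite /= -expgM gammaX /= -addnA -mulnDr.
rewrite -(modnDml a j); move: (a %% d + j) => x.
have -> : i + k * x = x %/ d * n + (i + k * (x %% d)).
  by rewrite {1}(divn_eq x d); ring.
by rewrite modnMDl modn_small // grid_subproof.
Qed.

Section Lift.
Variables (w : 'S_k) (b : {ffun 'I_k -> 'I_d}).

Lemma excs_le i : excs w b i <= d.
Proof. by rewrite /excs; have := ltn_ord (b i); case: (i < w i); lia. Qed.

(** The residue of minus [excs w b i] modulo [d], as a natural number. *)
Definition shift i := d - excs w b i.

Definition lift_fun (p : 'I_n) : 'I_n := grid (w (col p)) (p %/ k + shift (col p)).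

Lemma lift_fun_grid i a : lift_fun (grid i a) = grid (w i) (a + shift i).
Proof.
by apply/eqP; rewrite /lift_fun col_grid row_grid eq_grid eqxx /= modnDml.
Qed.

Lemma lift_fun_inj : injective lift_fun.
Proof.
move=> p q; rewrite -(gridK p) -(gridK q) !lift_fun_grid => /eqP.
rewrite eq_grid => /andP[/eqP/perm_inj -> e]; apply/eqP; rewrite eq_grid eqxx /=.
by rewrite eqn_modDr in e.
Qed.

Definition lift_cent : 'S_n := perm lift_fun_inj.

Lemma lift_grid i a : lift_cent (grid i a) = grid (w i) (a + shift i).
Proof. by rewrite permE lift_fun_grid. Qed.

Lemma lift_cent_commute : lift_cent \in 'C[gamma n ^+ k]%g.
Proof.
apply/cent1P/permP => p; rewrite -(gridK p) !permM -[(gamma n ^+ k)%g]expg1.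
by rewrite gammaX_grid !lift_grid gammaX_grid addnAC.
Qed.

Lemma liftX_grid j i a :
  (lift_cent ^+ j)%g (grid i a) =
  grid ((w ^+ j)%g i) (a + \sum_(l < j) shift ((w ^+ l)%g i)).
Proof.
elim: j => [|j IH]; first by rewrite !expg0 !perm1 big_ord0 addn0.
by rewrite !expgSr !permM IH lift_grid big_ord_recr /= addnA.
Qed.

(** Rows below [excs w b i] move up and the others move down. The row is unchanged only if [excs] is
    [d], which forces [i < w i], or 0, which forbids it; the columns then decide. *)
Lemma exc_cell (i : 'I_k) a : a < d ->
  (grid i a < lift_cent (grid i a)) = (a < excs w b i).
Proof.
move=> ad; rewrite lift_grid /= /shift (modn_small ad).
have := excs_le i; have := ltn_ord i; have := ltn_ord (w i).
have : excs w b i = b i + (i < w i) by [].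
move: (excs w b i) => e eE wk ik ed.
have [ae|ea] := ltnP a e.
  have -> : (a + (d - e)) %% d = a + (d - e) by rewrite modn_small //; lia.
  by have := ltn_ord (b i); move: eE; case: ltnP; nia.
have -> : (a + (d - e)) %% d = a - e.
  have -> : a + (d - e) = (a - e) + d by lia.
  by rewrite modnDr modn_small //; lia.
by move: eE; case: ltnP; nia.
Qed.

Lemma exc_lift : exc lift_cent = \sum_i excs w b i.
Proof.
rewrite exc_sum (reindex (fun q : 'I_k * 'I_d => grid q.1 q.2)) /=; last first.
  exists (fun p => (col p, Ordinal (row_lt p))) => [[i a] _|p _] /=.
    congr (_, _); rewrite ?col_grid //; apply: val_inj.
    by rewrite [LHS]row_grid modn_small.
  exact: gridK.
rewrite -(pair_bigA _ (fun i (a : 'I_d) => grid i a < lift_cent (grid i a) : nat)) /=.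
apply: eq_bigr => i _; under eq_bigr => a _ do rewrite exc_cell //.
rewrite -[RHS]card_ord -sum1_card (big_ord_widen d (fun=> 1)) ?excs_le //.
by rewrite [RHS]big_mkcond /=; apply: eq_bigr => a _; case: ltnP.
Qed.

(** The j-th power fixes [grid i a] iff the length [l] of the cycle of [i] divides [j] and the total
    shift [S] around that cycle, taken j / l times, vanishes modulo [d]. *)
Lemma card_porbit_lift i a :
  #|porbit lift_cent (grid i a)| * gcdn (\sum_(j in porbit w i) excs w b j) d =
  #|porbit w i| * d.
Proof.
set E := \sum_(j in _) _; set l := #|porbit w i|.
have l0 : 0 < l by rewrite lt0n card_porbit_neq0.
set S := \sum_(j in porbit w i) shift j.
have SE : S + E = l * d.
  rewrite /S /E /l -big_split /= -sum_nat_const; apply: eq_bigr => j _.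
  by rewrite subnK // excs_le.
(* By [SE], [S] is minus [E] modulo [d]. *)
have gE : gcdn E d = gcdn S d.
  apply/eqP; rewrite eqn_dvd !dvdn_gcd !dvdn_gcdr !andbT; apply/andP; split.
    rewrite -(dvdn_addl _ (dvdn_gcdl E d)) SE; exact: dvdn_mull (dvdn_gcdr _ _).
  rewrite -(dvdn_addr _ (dvdn_gcdl S d)) SE; exact: dvdn_mull (dvdn_gcdr _ _).
have dvdP j : (#|porbit lift_cent (grid i a)| %| j) =
    (l %| j) && (d %/ gcdn S d %| j %/ l).
  rewrite -permX_fixed liftX_grid eq_grid permX_fixed -/l; apply: andb_id2l.
  move=> /dvdnP[q ->]; rewrite mulnK // [q * l]mulnC sum_porbitM -/S.
  by rewrite -[X in _ == X %[mod _]]addn0 eqn_modDl mod0n -/(dvdn _ _) dvdn_mul_gcd.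
have -> : #|porbit lift_cent (grid i a)| = l * (d %/ gcdn S d).
  apply/eqP; rewrite eqn_dvd dvdP dvdn_mulr //= mulKn // dvdnn /=.
  have := dvdnn #|porbit lift_cent (grid i a)|; rewrite {1}dvdP => /andP[h1 h2].
  by rewrite -(divnK h1) mulnC dvdn_pmul2r.
by rewrite gE -mulnA divnK // dvdn_gcdr.
Qed.

End Lift.

(** Row 0 reveals [w] and the shifts modulo [d], hence [excs] modulo [d]; with [w] known this
    determines each [b i < d]. *)
Lemma lift_cent_inj :
  injective (fun q : 'S_k * {ffun 'I_k -> 'I_d} => lift_cent q.1 q.2).
Proof.
move=> [w b] [w' b'] /= e.
have h i : (w i == w' i) && (shift w b i == shift w' b' i %[mod d]).
  by have := lift_grid w b i 0; rewrite e lift_grid => /eqP; rewrite eq_sym eq_grid.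
have ww : w = w' by apply/permP => i; have /andP[/eqP] := h i.
subst w'; congr (_, _); apply/ffunP => i; apply: val_inj.
(* Adding both [excs] values removes the truncated subtractions. *)
have /andP[_] := h i; rewrite -(eqn_modDr (excs w b i + excs w b' i)).
have -> : shift w b i + (excs w b i + excs w b' i) = excs w b' i + d.
  by have := excs_le w b i; rewrite /shift; lia.
have -> : shift w b' i + (excs w b i + excs w b' i) = excs w b i + d.
  by have := excs_le w b' i; rewrite /shift; lia.
by rewrite !modnDr eqn_modDr !modn_small // => /eqP.
Qed.

(** Commuting with the row shift, [s] is determined by its values on row 0: their columns give [w],
    their rows give [b]. *)
Lemma lift_cent_surj (s : 'S_n) : s \in 'C[gamma n ^+ k]%g ->
  exists w b, s = lift_cent w b.
Proof.
move/cent1P => sg.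
have comm j : commute s ((gamma n ^+ k) ^+ j)%g by apply: commuteX.
have sE i a : s (grid i a) = grid (col (s (grid i 0))) (s (grid i 0) %/ k + a).
  rewrite -[a in LHS]add0n -gammaX_grid -permM -comm permM.
  by rewrite -{1}[s (grid i 0)]gridK gammaX_grid.
have w_inj : injective (fun i => col (s (grid i 0))).
  (* Starting each column at the row of the other image brings both images to row [a + c] of the
     same column. *)
  move=> i j /= e; pose a := s (grid j 0) %/ k; pose c := s (grid i 0) %/ k.
  have : s (grid i a) = s (grid j c) by rewrite (sE i) (sE j) e addnC.
  by move/perm_inj/eqP; rewrite eq_grid => /andP[/eqP].
pose w := perm w_inj.
(* Solves shift = row of [s (grid i 0)] modulo [d]. That row is below [d], so neither subtraction
   truncates. *)
pose b : {ffun 'I_k -> 'I_d} :=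
  [ffun i : 'I_k => Ordinal (ltn_pmod (d - s (grid i 0%N) %/ k - (i < w i)) d_gt0)].
exists w, b; apply/permP => p; rewrite -(gridK p) lift_grid sE.
apply/eqP; rewrite eq_grid permE eqxx /= addnC eqn_modDl.
move: (col p) => {p} i; rewrite -(eqn_modDr (excs w b i)) subnK ?excs_le //.
rewrite /excs ffunE /= addnCA modnDml.
have : s (grid i 0) %/ k < d by apply: row_lt.
move: (s _ %/ k) => c cd; rewrite [X in X == _ %[mod d]](_ : _ = d) //.
by case: (i < w i); lia.
Qed.

Lemma sum_centralizer r m : 0 < r -> n = r * m ->
  (\sum_(j < n) #|'C[gamma n ^+ k]%g :&: S_rect n r m j|%:R *: 'X^j =
   perm_sum (@cycle_weight r d k) setT :> {poly rat})%R.
Proof.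
move=> r_gt0 n_rm; rewrite perm_sum_cycle_weight // pair_big /=.
(* The last point is never an excedance, so the range [j < n] captures every exponent. *)
have exc_lt (s : 'S_n) : exc s < n.
  have n0 : n.-1 < n by rewrite prednK ?muln_gt0 ?d_gt0.
  rewrite -[ltnRHS]card_ord -cardsT; apply: proper_card; apply/properP.
  split; first exact: subsetT.
  exists (Ordinal n0); rewrite inE // -leqNgt /= -ltnS prednK ?muln_gt0 ?d_gt0 //.
transitivity (\sum_(s in 'C[gamma n ^+ k]%g | cycle_type s == nseq m r)
    'X^(exc s) : {poly rat})%R.
  rewrite (partition_big (fun s => Ordinal (exc_lt s)) xpredT) //=.
  apply: eq_bigr => j _; rewrite -sumr_const scaler_suml.
  apply: eq_big => [s|s]; first by rewrite !inE -val_eqE /= andbA.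
  by rewrite !inE => /and3P[_ _ /eqP ->]; rewrite scale1r.
rewrite big_mkcondr /=.
have -> : 'C[gamma n ^+ k]%g =
    [set lift_cent q.1 q.2 | q in [set: 'S_k * {ffun 'I_k -> 'I_d}]].
  apply/setP => s; apply/idP/imsetP => [/lift_cent_surj[w [b ->]]|[q _ ->]].
    by exists (w, b).
  exact: lift_cent_commute.
rewrite big_imset /=; last by move=> q q' _ _; apply: lift_cent_inj.
apply: eq_big => [q|[w b] _ /=]; first by rewrite inE.
rewrite exc_lift; congr (if _ then _ else _).
rewrite (cycle_type_rect _ r_gt0 n_rm); apply/forallP/forall_inP => [h C|h p].
  case/imsetP=> i _ ->; rewrite /lift_ok -(card_porbit_lift w b i 0).
  by rewrite (eqP (h _)).
have := h _ (porbits_porbit w (col p)); rewrite /lift_ok.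
rewrite -(card_porbit_lift w b (col p) (p %/ k)) gridK eqn_pmul2r //.
by rewrite gcdn_gt0 d_gt0 orbT.
Qed.

End Centralizer.

Local Open Scope ring_scope.

Theorem theorem5p7 (n r m d k : nat)
  (n_gt0 : (0 < n)%N) (r_gt1 : (1 < r)%N) (m_gt0 : (0 < m)%N)
  (d_gt0 : (0 < d)%N) (k_gt0 : (0 < k)%N)
  (n_rm : n = (r * m)%N) (n_dk : n = (d * k)%N) :
  \sum_(j < n) #|'C[gamma n ^+ k]%g :&: S_rect n r m j|%:R *: 'X^j
  = \sum_(mu in Par m d r)
      pi_partn [seq scale_part r d x | x <- mu] *:
      \prod_(x <- mu)
        gcd_part ('X * eulerian (scale_part r d x).-1
                     * tbracket d ^+ scale_part r d x) d x
  :> {poly rat}.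
Proof.
have r_gt0 : (0 < r)%N := ltnW r_gt1.
(* Both sides become the sum of cycle weights over the permutations of the [k] columns. *)
rewrite (partn_sum_scale r_gt0 d_gt0 (etrans (esym n_rm) n_dk)).
rewrite -perm_sum_weight_partn // n_dk sum_centralizer //.
by rewrite -n_dk.
Qed.
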